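(* The linear algebraic system $$\underline{c}_j^{N}=\Big(\underline{\bar\psi}_j^{N}+\sum_{r=1}^{n}\underline{c}_r^{N}\,\mathcal{J}^{N}A_{j,r}^{N}+T^{\theta_j}\,\underline{\hat p}_{j,n+1}^{N}\,Q_j^{N}\Big)(\mathcal{J}^{N})^{-1},\qquad j=1,2,\dots,n,$$ for the unknown row vectors $\underline{c}_j^{N}=[c_{j,0},\dots,c_{j,N}]$, $j=1,\dots,n$, has a unique solution obtained by a determined recurrence relation.
   Context: Setting: $n\ge1$, $T>0$ finite, $N\ge 0$ an integer (the approximation degree), $\theta_j=\gamma_j/q_j$ with co-prime integers $\gamma_j\ge1$, $q_j\ge2$ ($j=1,\dots,n$), $q=\operatorname{lcm}(q_1,\dots,q_n)$, $\eta=1/q$. The system is the Müntz-Jacobi Galerkin discretization of the linear system of fractional differential equations $D_C^{\theta_j}v_j(t)=\sum_{r=1}^n p_{j,r}(t)v_r(t)+p_{j,n+1}(t)$, $j=1,\dots,n$, on $[0,T]$ with continuous functions $p_{j,r}$ and initial values $v_j^{(k)}(0)=v_{j,0}^{(k)}$, $0\le k\le\lceil\theta_j\rceil-1$ ($D_C^{\theta_j}$ is the Caputo derivative of order $\theta_j$), rescaled to $u=t/T\in[0,1]$. The approximate solution is $\bar v_{j,N}(u)=\sum_{i=0}^{N}c_{j,i}\,\mathcal{J}_i^{(0,q-1)}(u)$, where $\mathcal{J}_i^{(0,q-1)}$ are the Müntz-Jacobi functions given below. All row vectors and square matrices with superscript $N$ are of order $N+1$ and are indexed by $0,\dots,N$;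 they are the leading sub-vectors or sub-matrices of the corresponding infinite ones, written without superscript. $\mathcal{J}$ is the invertible lower triangular matrix of coefficients of the Müntz-Jacobi functions $\mathcal{J}_i^{(0,q-1)}(u)=\sum_{m=0}^{i}\mathcal{J}_{i,m}\,u^{m\eta}$, namely $$\mathcal{J}_{i,m}=\frac{(-1)^{i-m}\,\Gamma(i+q)\,\Gamma(i+q+m)}{\Gamma(q+m)\,m!\,\Gamma(i+q)\,(i-m)!},\quad 0\le m\le i.$$ $\underline{\bar\psi}_j^N=[\bar\psi_{j,0},\dots,\bar\psi_{j,N}]$, where $\bar\psi_j(u)=\sum_{k=0}^{\lceil\theta_j\rceil-1}\frac{v_{j,0}^{(k)}}{k!}(Tu)^k=\sum_i\bar\psi_{j,i}u^{i\eta}$. $\underline{\hat p}_{j,r}^N=[\hat p_{j,r,0},\dots,\hat p_{j,r,N}]$ ($r=1,\dots,n+1$) are the coefficients in the expansion $\sum_i \hat p_{j,r,i}u^{i\eta}$ used to represent $\bar p_{j,r}(u)=p_{j,r}(Tu)$; they are obtained from the Müntz-Jacobi coefficient vector $\underline p_{j,r}=[p_{j,r,0},\dots,p_{j,r,N},0,\dots]$ in the representation $\bar p_{j,r}=\sum_i p_{j,r,i}\mathcal{J}_i^{(0,q-1)}$ by $\underline{\hat p}_{j,r}=\underline p_{j,r}\mathcal{J}$. With $\xi_{j,i}^{m}=\frac{\Gamma((i+m)\eta+1)}{\Gamma((i+m)\eta+\theta_j+1)}$ and $\vartheta_j^m=\frac{\Gamma(m\eta+1)}{\Gamma(m\eta+\theta_j+1)}$,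 the infinite matrices $A_{j,r}$ ($j,r=1,\dots,n$) and $Q_j$ have entries, for $k,\ell\ge0$, $$(A_{j,r})_{k,\ell}=\begin{cases}0,& k\ge \ell-\theta_jq+1,\\ T^{\theta_j}\,\hat p_{j,r,\ell-k-\theta_jq}\;\xi_{j,\ell-k-\theta_jq}^{k},& k<\ell-\theta_jq+1,\end{cases}\qquad (Q_j)_{k,\ell}=\begin{cases}\vartheta_j^k,&\ell=k+\theta_jq,\\0,&\text{otherwise.}\end{cases}$$ *)

(* Defs.v *)
From HB Require Import structures.
From mathcomp Require Import all_boot all_order all_algebra.
From mathcomp Require Import all_classical all_reals all_analysis.
From mathcomp Require Import ring.

Set Implicit Arguments.
Unset Strict Implicit.
Unset Printing Implicit Defensive.

Import Order.TTheory GRing.Theory Num.Theory.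
Import numFieldNormedType.Exports.

Local Open Scope classical_set_scope.
Local Open Scope ring_scope.

Definition Gamma (R : realType) (x : R) : R :=
  Rintegral lebesgue_measure `]0, +oo[ (fun t : R => t `^ (x - 1) * expR (- t)).

Definition leading_row (R : realType) (N : nat) (a : nat -> R) : 'rV[R]_N.+1 :=
  \row_(i < N.+1) a i.

Definition leading_mx (R : realType) (N : nat) (A : nat -> nat -> R) :
    'M[R]_N.+1 :=
  \matrix_(k < N.+1, l < N.+1) A k l.

Section MuntzJacobi.
Variables (R : realType) (q : nat).

Definition MJ (i m : nat) : R :=
  if (m <= i)%N then
    (-1) ^+ (i - m) * Gamma (i + q)%:R * Gamma (i + q + m)%:R /
    (Gamma (q + m)%:R * m`!%:R * Gamma (i + q)%:R * (i - m)`!%:R)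
  else 0.

Definition MJ_function (i : nat) (u : R) : R :=
  \sum_(m < i.+1) MJ i m * u `^ (m%:R / q%:R).

(* The only thing required of the passage from a function to its coefficient
   vector is that it returns the coefficients of every function that is a
   combination of the first N + 1 Muntz-Jacobi functions; orthogonal projection
   and interpolation are instances. *)
Definition MJ_coefficient_rule (N : nat) (coef : (R -> R) -> nat -> R) : Prop :=
  forall (f : R -> R) (a : nat -> R),
    (forall u, 0 <= u <= 1 -> f u = \sum_(i < N.+1) a i * MJ_function i u) ->
    forall i, (i <= N)%N -> coef f i = a i.

(* The row vector [coef f 0, ..., coef f N, 0, ...] times the infinite matrix
   MJ. *)
Definition power_coef (N : nat) (coef : (R -> R) -> nat -> R) (f : R -> R)
    (m : nat) : R :=
  \sum_(i < N.+1) coef f i * MJ i m.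

End MuntzJacobi.

Section Galerkin.
Variables (R : realType) (n : nat) (T : R) (N : nat).
Variables (gamma qd : 'I_n -> nat).
Variable v0 : 'I_n -> nat -> R.
(* p j r, for r < n, multiplies v_r in the j-th equation; p j ord_max is the
   source term. *)
Variable p : 'I_n -> 'I_n.+1 -> R -> R.
Variable coef : (R -> R) -> nat -> R.

Definition theta (j : 'I_n) : R := (gamma j)%:R / (qd j)%:R.

Definition qlcm : nat := \big[lcmn/1%N]_(j < n) qd j.

Definition eta : R := qlcm%:R^-1.

(* The integer theta j * q. *)
Definition theta_q (j : 'I_n) : nat := (gamma j * (qlcm %/ qd j))%N.

Lemma theta_qE (j : 'I_n) : (0 < qd j)%N -> (theta_q j)%:R = theta j * qlcm%:R.
Proof.
move=> qj0; have qjq : (qd j %| qlcm)%N by rewrite /qlcm (bigD1 j) //= dvdn_lcml.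
rewrite /theta_q /theta -[X in _ = _ * X%:R](divnK qjq) !natrM.
by field; rewrite pnatr_eq0 -lt0n.
Qed.

Definition psi_coef (j : 'I_n) (i : nat) : R :=
  \sum_(k < `|Num.ceil (theta j)|%N | (k * qlcm)%N == i)
    v0 j k / k`!%:R * T ^+ k.

Definition p_hat (j : 'I_n) (r : 'I_n.+1) : nat -> R :=
  power_coef qlcm N coef (fun u => p j r (T * u)).

Definition xi (j : 'I_n) (i m : nat) : R :=
  Gamma ((i + m)%:R * eta + 1) / Gamma ((i + m)%:R * eta + theta j + 1).

Definition vartheta (j : 'I_n) (m : nat) : R :=
  Gamma (m%:R * eta + 1) / Gamma (m%:R * eta + theta j + 1).

Definition A_mx (j r : 'I_n) (k l : nat) : R :=
  if (l + 1 <= k + theta_q j)%N then 0 else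
    let d := (l - k - theta_q j)%N in
    T `^ theta j * p_hat j (widen_ord (leqnSn n) r) d * xi j d k.

Definition Q_mx (j : 'I_n) (k l : nat) : R :=
  if l == (k + theta_q j)%N then vartheta j k else 0.

Definition solves_system (c : 'I_n -> 'rV[R]_N.+1) : Prop :=
  forall j : 'I_n,
    c j =
    (leading_row N (psi_coef j)
     + (\sum_(r < n) c r *m leading_mx N (@MJ R qlcm) *m leading_mx N (A_mx j r))
     + T `^ theta j *: (leading_row N (p_hat j ord_max) *m leading_mx N (Q_mx j)))
    *m invmx (leading_mx N (@MJ R qlcm)).

(* The recurrence is for the coefficients of u ^ (l * eta) in the approximate
   solutions, that is for the entries of c_j *m MJ. As 0 < theta_q j, the value of
   index l is computed from values of smaller index only. *)
Definition recurrence_step (z : nat -> 'I_n -> R) (l : nat) (j : 'I_n) : R :=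
  psi_coef j l
  + (\sum_(r < n) \sum_(k < l | (k + theta_q j <= l)%N)
      let d := (l - k - theta_q j)%N in
      z k r * (T `^ theta j * p_hat j (widen_ord (leqnSn n) r) d * xi j d k))
  + (if (theta_q j <= l)%N then
       T `^ theta j * p_hat j ord_max (l - theta_q j) * vartheta j (l - theta_q j)
     else 0).

Fixpoint recurrence_prefix (l : nat) : seq ('I_n -> R) :=
  if l is l'.+1 then
    let s := recurrence_prefix l' in
    rcons s (recurrence_step (nth (fun=> 0) s) l')
  else [::].

Definition recurrence_sol (l : nat) : 'I_n -> R :=
  nth (fun=> 0) (recurrence_prefix l.+1) l.

Lemma size_recurrence_prefix (l : nat) : size (recurrence_prefix l) = l.
Proof. by elim: l => //= l IHl; rewrite size_rcons IHl. Qed.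

Lemma nth_recurrence_prefix (l k : nat) : (k < l)%N ->
  nth (fun=> 0) (recurrence_prefix l) k = recurrence_sol k.
Proof.
elim: l => // l IHl; rewrite ltnS leq_eqVlt => /predU1P[->//|kl] /=.
by rewrite nth_rcons size_recurrence_prefix kl IHl.
Qed.

Lemma recurrence_solE (l : nat) (j : 'I_n) :
  recurrence_sol l j = recurrence_step recurrence_sol l j.
Proof.
rewrite {1}/recurrence_sol /= nth_rcons size_recurrence_prefix ltnn eqxx.
rewrite /recurrence_step; congr (_ + _ + _).
apply: eq_bigr => r _; apply: eq_bigr => k _.
by rewrite nth_recurrence_prefix.
Qed.

Lemma psi_coefE (j : 'I_n) (u : R) : (0 < qlcm)%N -> 0 <= u ->
  \sum_(k < `|Num.ceil (theta j)|%N) v0 j k / k`!%:R * (T * u) ^+ k =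
  \sum_(i < (`|Num.ceil (theta j)| * qlcm)%N) psi_coef j i * u `^ (i%:R * eta).
Proof.
move=> q0 u0; under [RHS]eq_bigr do rewrite mulr_suml.
rewrite (exchange_big_dep xpredT) //=; apply: eq_bigr => k _.
have kq : (k * qlcm < `|Num.ceil (theta j)| * qlcm)%N by rewrite ltn_pmul2r.
rewrite (big_pred1 (Ordinal kq)) /= => [|i]; last first.
  by apply/eqP/eqP => [kqi|->//]; exact/val_inj.
rewrite natrM /eta mulfK ?pnatr_eq0 -?lt0n // powR_mulrn //.
by rewrite exprMn mulrA.
Qed.

End Galerkin.

(* Main.v *)
Require Import Defs.
From HB Require Import structures.
From mathcomp Require Import all_boot all_order all_algebra.
From mathcomp Require Import all_classical all_reals all_analysis.
From mathcomp Require Import measurable_realfun ring.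

Set Implicit Arguments.
Unset Strict Implicit.
Unset Printing Implicit Defensive.

Import Order.TTheory GRing.Theory Num.Theory.
Import numFieldNormedType.Exports.

Local Open Scope classical_set_scope.
Local Open Scope ring_scope.

(** The matrix [M] of the Muntz-Jacobi coefficients is lower triangular, and its
diagonal entries are quotients of products of Gamma values at positive integers
and factorials. These are nonzero ([Gamma_nat_gt0]), so [M] is invertible
([unitmx_MJ]) and the change of unknowns [w_j = c_j *m M] is a bijection: [w_j]
lists the coefficients of the powers [u ^ (l / q)] in the j-th approximate
solution, [c_j] those of the Muntz-Jacobi functions.

In the unknowns [w_j] the factor [invmx M] disappears from the system, and what
remains is triangular. Fractional integration of order [theta_j] raises the
exponent index by the integer [theta_j * q], which is positive, so [A_mx] is
strictly upper triangular and [Q_mx] is a shift of the index by the same amount.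
Read entry by entry, the system therefore says that the entries of index [l]
are given by [recurrence_step] in terms of entries of index smaller than [l]
([solves_system_recurrence]). By strong induction on [l] such a family exists
and is unique: it is [recurrence_sol] ([recurrence_uniq], [recurrence_solE]).
Going back through [invmx M] gives the unique solution of the original system
([solves_systemP]). *)

Section GammaNat.
Variable R : realType.
Notation mu := (@lebesgue_measure R).

Lemma exp_coeff_le_expR (x : R) (n : nat) : 0 <= x -> x ^+ n / n`!%:R <= expR x.
Proof.
case: n => [|n] x0; first by rewrite expr0 fact0 divr1 -expR0 ler_expR.
by apply: le_trans (expR_ge1Dxn n x0); rewrite lerDr.
Qed.

(** [t ^ n] is dominated by a multiple of [expR (t / 2)], so the integrand is
dominated by a multiple of [expR (- t / 2)], which up to a factor is the density
of the exponential distribution of rate 1/2. *)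
Lemma integrable_Gamma_nat (n : nat) :
  mu.-integrable `]0, +oo[
    (EFin \o (fun t : R => t `^ (n.+1%:R - 1) * expR (- t))).
Proof.
(* From [(t / 2) ^ n / n! <= expR (t / 2)]; the additional factor 2 makes up for
   the rate in front of the exponential density. *)
pose C : R := 2 ^+ n.+1 * n`!%:R.
apply: (@le_integrable _ _ _ mu _ _ _
  (fun t => C%:E * (EFin \o exponential_pdf 2^-1) t)%E) => //.
- apply/measurable_EFinP; apply: measurable_funTS; apply: measurable_funM.
    exact: measurable_powR.
  by apply: measurableT_comp => //; exact: measurable_funN.
- move=> t /=; rewrite in_itv/= andbT => t0.
  rewrite lee_fin -[n.+1%:R]natr1 addrK powR_mulrn; last exact: ltW.
  have C0 : 0 <= C by rewrite mulr_ge0// exprn_ge0.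
  rewrite !ger0_norm; last 2 first.
  + by rewrite mulr_ge0// exponential_pdf_ge0// invr_ge0.
  + by rewrite mulr_ge0 ?expR_ge0// exprn_ge0 ?ltW.
  rewrite exponential_pdfE; last exact: ltW.
  have -> : expR (- t) = expR (- (t / 2)) * expR (- (t / 2)).
    by rewrite -expRD -opprD -splitr.
  rewrite mulNr [2^-1 * t]mulrC !mulrA ler_wpM2r ?expR_ge0//.
  have -> : C / 2 = 2 ^+ n * n`!%:R by rewrite /C exprS; field.
  rewrite expRN ler_pdivrMr ?expR_gt0// mulrC -ler_pdivrMr; last first.
    by rewrite mulr_gt0 ?exprn_gt0// ltr0n fact_gt0.
  rewrite invfM mulrA -expr_div_n.
  exact/exp_coeff_le_expR/ltW/divr_gt0.
- apply: integrableZl => //; apply: (@integrableS _ _ _ mu setT) => //.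
  by apply: integrable_exponential_pdf; rewrite invr_gt0.
Qed.

(** Integrability matters here as much as positivity of the integrand: the real
valued integral is 0 when the extended real one is infinite. On [[1, 2]] the
integrand is at least [expR (- 2)]. *)
Lemma Gamma_nat_gt0 (n : nat) : 0 < Gamma (n.+1%:R : R).
Proof.
pose f (t : R) : R := t `^ (n.+1%:R - 1) * expR (- t).
have int_f := integrable_Gamma_nat n.
have sub12 : (`[1%R, 2%R]%classic : set R) `<=` `]0%R, +oo[%classic.
  by move=> t /=; rewrite !in_itv/= andbT => /andP[/(lt_le_trans ltr01)].
rewrite /Gamma /Rintegral fine_gt0//; apply/andP; split; last first.
  have := integrable_fin_num _ int_f; rewrite fin_numE => /(_ _)/andP[//|_].
  by move=> ioo; rewrite lt_neqAle ioo// leey.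
have f_ge0 (t : R) : 0 <= f t by rewrite mulr_ge0 ?powR_ge0 ?expR_ge0.
apply: (@lt_le_trans _ _ (\int[mu]_(t in `[1%R, 2%R]) (expR (- 2))%:E)%E).
  rewrite integral_cst//= lebesgue_measure_itv/= lte_fin ltr1n.
  by rewrite -EFinD -EFinM lte_fin mulr_gt0 ?expR_gt0 ?subr_gt0 ?ltr1n.
have mf := measurable_int mu int_f.
apply: le_trans (ge0_subset_integral _ _ _ mf _ sub12) => //.
  apply: ge0_le_integral => //; first exact: measurable_funS mf.
  move=> t /=; rewrite in_itv/= => /andP[t1 t2].
  rewrite lee_fin -[X in X <= _]mul1r ler_pM ?expR_ge0//; last first.
    by rewrite ler_expR lerN2.
  rewrite -[n.+1%:R]natr1 addrK powR_mulrn ?exprn_ege1//.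
  exact: le_trans t1.
by move=> t _; rewrite lee_fin; exact: f_ge0.
Qed.

End GammaNat.

(** By triangularity only the diagonal matters, and [0 < q] keeps the arguments of
Gamma on it at positive integers, including those for [i = 0]. *)
Lemma unitmx_MJ (R : realType) (q N : nat) : (0 < q)%N ->
  leading_mx N (@MJ R q) \in unitmx.
Proof.
move=> q_gt0.
have G0 m : (0 < m)%N -> Gamma (m%:R : R) != 0.
  by case: m => // m _; rewrite gt_eqF// Gamma_nat_gt0.
have trigM : is_trig_mx (leading_mx N (@MJ R q)).
  by apply/is_trig_mxP => i j ij; rewrite mxE /MJ leqNgt ij.
rewrite unitmxE det_trig// unitfE; apply/prodf_neq0 => i _.
rewrite mxE /MJ leqnn subnn expr0 mul1r fact0 mulr1.
by rewrite mulf_neq0// ?invr_neq0// !mulf_neq0// ?G0// ?addn_gt0 ?q_gt0 ?orbT//.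
Qed.

Section Recurrence.
Variables (R : realType) (n : nat) (T : R) (N : nat).
Variables (gamma qd : 'I_n -> nat) (v0 : 'I_n -> nat -> R).
Variables (p : 'I_n -> 'I_n.+1 -> R -> R) (coef : (R -> R) -> nat -> R).
Hypothesis gamma_gt0 : forall j, (0 < gamma j)%N.
Hypothesis qd_gt0 : forall j, (0 < qd j)%N.

Let M := leading_mx N (@MJ R (qlcm qd)).
Let step := recurrence_step T N gamma qd v0 p coef.
Let sol := recurrence_sol T N gamma qd v0 p coef.

Lemma qlcm_gt0 : (0 < qlcm qd)%N.
Proof.
rewrite /qlcm; elim/big_ind: _ => // a b a0 b0.
by rewrite lcmn_gt0 a0.
Qed.

(** The strict shift of the index that makes the system triangular in the
coefficients of the powers of [u]; it holds as [qd j] divides the lcm. *)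
Lemma theta_q_gt0 (j : 'I_n) : (0 < theta_q gamma qd j)%N.
Proof.
rewrite muln_gt0 gamma_gt0 divn_gt0 ?qd_gt0// dvdn_leq ?qlcm_gt0//.
by rewrite /qlcm (bigD1 j)//= dvdn_lcml.
Qed.

Lemma eq_recurrence_step (w z : nat -> 'I_n -> R) (l : nat) (j : 'I_n) :
  (forall k, (k < l)%N -> w k =1 z k) -> step w l j = step z l j.
Proof.
move=> wz; rewrite /step /recurrence_step; congr (_ + _ + _).
by apply: eq_bigr => r _; apply: eq_bigr => k _; rewrite wz.
Qed.

Lemma recurrence_uniq (w : nat -> 'I_n -> R) :
  (forall l, (l <= N)%N -> w l =1 step w l) ->
  forall l, (l <= N)%N -> w l =1 sol l.
Proof.
move=> w_rec; elim/ltn_ind => l IHl lN j.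
rewrite w_rec// /sol recurrence_solE; apply: eq_recurrence_step => k kl.
by apply: IHl => //; exact: leq_trans (ltnW kl) lN.
Qed.

(** The product runs over all [k <= N], but since [theta_q] is positive the nonzero
entries of column [l] lie in rows [k < l]; the sum can thus be cut at [l]. *)
Lemma mul_row_A_mx (w : nat -> R) (j r : 'I_n) (l : 'I_N.+1) :
  (leading_row N w *m leading_mx N (A_mx T N gamma qd p coef j r)) 0 l =
  \sum_(k < l | (k + theta_q gamma qd j <= l)%N)
    let d := (l - k - theta_q gamma qd j)%N in
    w k * (T `^ theta R gamma qd j
           * p_hat T N qd p coef j (widen_ord (leqnSn n) r) d
           * xi R gamma qd j d k).
Proof.
rewrite mxE /=.
rewrite (big_ord_widen_cond N.+1 (fun k => (k + theta_q gamma qd j <= l)%N)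
  (fun k => w k * (T `^ theta R gamma qd j
     * p_hat T N qd p coef j (widen_ord (leqnSn n) r)
         (l - k - theta_q gamma qd j)
     * xi R gamma qd j (l - k - theta_q gamma qd j) k))); last exact: ltnW.
rewrite [RHS]big_mkcond /=; apply: eq_bigr => k _.
rewrite !mxE /A_mx addn1 ltnNge.
have [kl|_] := leqP (k + theta_q gamma qd j)%N l; last by rewrite mulr0.
by rewrite (leq_trans _ kl)// -addn1 leq_add2l theta_q_gt0.
Qed.

Lemma mul_row_Q_mx (a : nat -> R) (j : 'I_n) (l : 'I_N.+1) :
  (leading_row N a *m leading_mx N (@Q_mx R n gamma qd j)) 0 l =
  if (theta_q gamma qd j <= l)%N then
    a (l - theta_q gamma qd j)%N
    * vartheta R gamma qd j (l - theta_q gamma qd j)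
  else 0.
Proof.
rewrite mxE; under eq_bigr do rewrite !mxE /Q_mx.
have [tl|lt] := leqP (theta_q gamma qd j) l; last first.
  apply: big1 => k _; rewrite ifF ?mulr0//; apply/negbTE.
  by rewrite neq_ltn (leq_trans lt)// leq_addl.
have kN : (l - theta_q gamma qd j < N.+1)%N.
  by rewrite (leq_ltn_trans (leq_subr _ _)).
rewrite (bigD1 (Ordinal kN))//= subnK// eqxx big1 ?addr0// => k /negP kl.
rewrite ifF ?mulr0//; apply/negP => /eqP lk; apply: kl.
by rewrite -val_eqE/= lk addnK.
Qed.

(** Multiplying both sides of the system by [M] on the right cancels [invmx M] on
the left and on the right of the equation, and [M] also cancels the [invmx M]
that occurs in the unknowns under the sum. *)
Lemma solves_system_recurrence (w : nat -> 'I_n -> R) :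
  solves_system T gamma qd v0 p coef
    (fun j => leading_row N (w^~ j) *m invmx M) <->
  (forall l, (l <= N)%N -> w l =1 step w l).
Proof.
have Mu : M \in unitmx by exact/unitmx_MJ/qlcm_gt0.
pose rhs j : 'rV[R]_N.+1 := leading_row N (psi_coef T gamma qd v0 j)
  + (\sum_(r < n) leading_row N (w^~ r)
       *m leading_mx N (A_mx T N gamma qd p coef j r))
  + T `^ theta R gamma qd j *: (leading_row N (p_hat T N qd p coef j ord_max)
       *m leading_mx N (Q_mx R gamma qd j)).
have rhsE j (l : 'I_N.+1) : rhs j 0 l = step w l j.
  rewrite /rhs mxE [X in X + _ = _]mxE summxE [X in _ + X = _]mxE mul_row_Q_mx.
  rewrite mxE; congr (_ + _ + _).
    by apply: eq_bigr => r _; rewrite mul_row_A_mx.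
  by case: ifP => _; rewrite ?mulr0 ?mulrA.
have sysE : solves_system T gamma qd v0 p coef
    (fun j => leading_row N (w^~ j) *m invmx M) <->
    (forall j, leading_row N (w^~ j) = rhs j).
  rewrite /solves_system; split=> H j; have := H j.
    rewrite -/M; under eq_bigr do rewrite mulmxKV//.
    by move/(congr1 (mulmx^~ M)); rewrite !mulmxKV.
  rewrite -/M; under [in X in _ -> X]eq_bigr do rewrite mulmxKV//.
  by move=> ->.
rewrite sysE; split=> [w_rec l lN j|w_rec j].
  have := congr1 (fun a : 'rV[R]_N.+1 => a 0 (inord l)) (w_rec j).
  by rewrite rhsE !mxE inordK.
by apply/rowP => l; rewrite rhsE mxE w_rec// -ltnS.
Qed.

(** Any family [c] has the form to which [solves_system_recurrence] applies, with
[w] read off from [c j *m M]. *)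
Lemma solves_systemP (c : 'I_n -> 'rV[R]_N.+1) :
  solves_system T gamma qd v0 p coef c <->
  forall j, c j = leading_row N (sol^~ j) *m invmx M.
Proof.
have Mu : M \in unitmx by exact/unitmx_MJ/qlcm_gt0.
pose w l j := (c j *m M) 0 (inord l : 'I_N.+1).
have rowwE j : leading_row N (w^~ j) = c j *m M.
  by apply/rowP => l; rewrite mxE /w inord_val.
split=> [c_sol j|cE].
  have cwE : c = fun j => leading_row N (w^~ j) *m invmx M.
    by apply/funext => i; rewrite rowwE mulmxK.
  rewrite cwE in c_sol; move/solves_system_recurrence/recurrence_uniq: c_sol => w_sol.
  rewrite -[LHS](mulmxK Mu) -rowwE; congr (_ *m _).
  by apply/rowP => l; rewrite !mxE w_sol// -ltnS.
rewrite (funext cE); apply/solves_system_recurrence => l _ j.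
exact: recurrence_solE.
Qed.

End Recurrence.

Theorem theorem3p2 (R : realType) (n : nat) (T : R) (N : nat)
    (gamma qd : 'I_n -> nat) (v0 : 'I_n -> nat -> R)
    (p : 'I_n -> 'I_n.+1 -> R -> R) (coef : (R -> R) -> nat -> R)
    (n_ge1 : (1 <= n)%N) (T_gt0 : 0 < T)
    (gamma_ge1 : forall j, (1 <= gamma j)%N)
    (qd_ge2 : forall j, (2 <= qd j)%N)
    (gamma_qd_coprime : forall j, coprime (gamma j) (qd j))
    (p_cont : forall j r, {within `[0, T], continuous (p j r)})
    (coef_rule : MJ_coefficient_rule (qlcm qd) N coef) :
  (exists! c : 'I_n -> 'rV[R]_N.+1,
     solves_system T gamma qd v0 p coef c) /\
  (forall c : 'I_n -> 'rV[R]_N.+1,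
     solves_system T gamma qd v0 p coef c ->
     forall j : 'I_n,
       c j = leading_row N
               (fun l => recurrence_sol T N gamma qd v0 p coef l j)
             *m invmx (leading_mx N (@MJ R (qlcm qd)))).
Proof.
have qd_gt0 j : (0 < qd j)%N by exact: leq_trans (qd_ge2 j).
have solP := solves_systemP T v0 p coef gamma_ge1 qd_gt0.
split; last by move=> c /solP.
eexists; split; first exact/solP.
by move=> c /solP cE; apply/funext => j; rewrite cE.
Qed.
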